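(* Let $(X,\mathcal T)$ be a $2n$-dimensional manifold equipped with a local $T^n$-action. The orbit map $\mu_X\colon X\to B_X$ has a $C^0$ section if and only if the Euler class $e(X,\mathcal T)\in H^1(B_X;\mathfrak S_{(P_X,\mathcal L_X)})$ vanishes.
   Context: Local torus actions. $T^n=(S^1)^n$ acts on $\mathbb C^n$ by the standard representation $u\cdot z=(u_1z_1,\dots,u_nz_n)$. $\mathrm{Aut}(T^n)$ is the group of automorphisms of $T^n$; a map $f$ is $\rho$-equivariant if $f(u\cdot x)=\rho(u)\cdot f(x)$. Let $X$ be a compact Hausdorff space. A weakly standard ($C^0$) atlas of $X$ is an atlas $\{(U^X_\alpha,\varphi^X_\alpha)\}$ such that (i) each $\varphi^X_\alpha$ is a homeomorphism from $U^X_\alpha$ onto a $T^n$-invariant open subset of $\mathbb C^n$; (ii) on each nonempty overlap $U^X_{\alpha\beta}$ the images $\varphi^X_\alpha(U^X_{\alpha\beta})$, $\varphi^X_\beta(U^X_{\alpha\beta})$ are $T^n$-invariant and there is $\rho_{\alpha\beta}\in\mathrm{Aut}(T^n)$ such that $\varphi^X_{\alpha\beta}=\varphi^X_\alpha\circ(\varphi^X_\beta)^{-1}$ is a $\rho_{\alpha\beta}$-equivariant homeomorphism. Overlaps are assumed connected. Two such atlases are equivalent if on each nonempty overlap the transition map is $\rho$-equivariant for some $\rho$. An equivalence class $\mathcal T$ is a local $T^n$-action on $X$. Orbit space. $\mathbb R^n_{\ge0}=\{\xi\in\mathbb R^n:\xi_i\ge0\}$, stratified by the number $k$ of nonzero coordinates;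 $\mu_{\mathbb C^n}(z)=(|z_1|^2,\dots,|z_n|^2)$. $B_X$ is obtained by gluing $U^B_\alpha:=\varphi^X_\alpha(U^X_\alpha)/T^n$ via the maps induced by $\varphi^X_{\alpha\beta}$; $\mu_X\colon X\to B_X$ is induced by the projections. The maps $\varphi^B_\alpha\colon U^B_\alpha\to\mathbb R^n_{\ge0}$ induced by $\mu_{\mathbb C^n}$ make $B_X$ a $C^0$ manifold with corners, with $k$-dimensional strata $\mathcal S^{(k)}B_X$. Characteristic pair. $\Lambda$ is the lattice of integral elements (kernel of $\exp$) in the Lie algebra of $T^n$, $\mathrm{Aut}(T^n)\cong\mathrm{GL}(\Lambda)$. $P_X=\coprod_\alpha U^B_\alpha\times\mathrm{Aut}(T^n)/\sim$ with $(b,h_\alpha)\sim(b,h_\beta)$ iff $h_\alpha=\rho_{\alpha\beta}\circ h_\beta$; $\Lambda_X$ and $\pi_{T_X}\colon T_X\to B_X$ are the associated $\Lambda$- and $T^n$-bundles. $\mathcal L_X\to\mathcal S^{(n-1)}B_X$ is the rank one subbundle of $\Lambda_X|_{\mathcal S^{(n-1)}B_X}$ which, over each component of $U^B_\alpha\cap\mathcal S^{(n-1)}B_X$ in the trivialization over $U^B_\alpha$, is spanned by the integral element generating the circle subgroup of $T^n$ fixing $\mu_{\mathbb C^n}^{-1}$ of the $\varphi^B_\alpha$-image of that component. Canonical model. For $b\in\mathcal S^{(k)}B_X$, the $n-k$ local components of $\mathcal S^{(n-1)}B_X$ near $b$ give rank one sublattices $L_1,\dots,L_{n-k}$, which generate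 an $(n-k)$-dimensional subtorus $Z_b$ of the group $\pi_{T_X}^{-1}(b)$ (trivial for $k=n$). $X_{(P_X,\mathcal L_X)}$ is the quotient of $T_X$ by $t\sim t'$ iff $\pi_{T_X}(t)=\pi_{T_X}(t')=:b$ and $t't^{-1}\in Z_b$. Its projection $\mu_{X_{(P_X,\mathcal L_X)}}$ to $B_X$ has abelian groups as fibers; $\mathfrak S_{(P_X,\mathcal L_X)}$ is the sheaf of its $C^0$ sections. Euler class. $T_X$ acts fiberwise on $X$ by $t\cdot x=(\varphi^X_\alpha)^{-1}(t_\alpha\cdot\varphi^X_\alpha(x))$, where $(b,t_\alpha)$ is the image of $t$ in the trivialization over $U^B_\alpha$; this descends to a fiberwise simply transitive action of $X_{(P_X,\mathcal L_X)}$. Choose $C^0$ isomorphisms (homeomorphisms compatible with the local $T^n$-actions) $h_\alpha\colon\mu_X^{-1}(U^B_\alpha)\to\mu_{X_{(P_X,\mathcal L_X)}}^{-1}(U^B_\alpha)$ covering the identity and equivariant for the fiberwise actions of $T_X$. The equations $h_\alpha\circ h_\beta^{-1}(x)=\theta^X_{\alpha\beta}(b)x$ for $b\in U^B_{\alpha\beta}$, $x\in\mu_{X_{(P_X,\mathcal L_X)}}^{-1}(b)$ define a Čech one-cocycle of sections, whose class $e(X,\mathcal T)\in H^1(B_X;\mathfrak S_{(P_X,\mathcal L_X)})$ is the Euler class of $\mu_X$. *)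

(* Defs.v *)
From HB Require Import structures.
From Stdlib Require Export Relation_Operators.
From mathcomp Require Export all_boot all_order all_algebra.
From mathcomp Require Export all_classical all_reals all_analysis.
From mathcomp Require Export complex.
Export Order.TTheory GRing.Theory Num.Theory numFieldNormedType.Exports.

Set Implicit Arguments.
Unset Strict Implicit.
Unset Printing Implicit Defensive.

Local Open Scope classical_set_scope.
Local Open Scope ring_scope.

(** * Quotients and homeomorphisms *)

Section Quotient.
Variables (T : topologicalType) (r : T -> T -> Prop).

(* The equivalence relation generated by r; when r already is an equivalence
   relation this is r itself. *)
Definition gen_equiv : rel T := fun x y => `[< clos_refl_sym_trans T r x y >].

Lemma gen_equiv_refl : reflexive gen_equiv.
Proof. by move=> x; apply/asboolP; exact: rst_refl. Qed.

Lemma gen_equiv_sym : symmetric gen_equiv.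
Proof. by move=> x y; apply/asboolP/asboolP; exact: rst_sym. Qed.

Lemma gen_equiv_trans : transitive gen_equiv.
Proof.
by move=> y x z /asboolP xy /asboolP yz; apply/asboolP; exact: rst_trans xy yz.
Qed.

Canonical gen_equiv_equiv :=
  EquivRel gen_equiv gen_equiv_refl gen_equiv_sym gen_equiv_trans.

Definition quot := quotient_topology {eq_quot gen_equiv}%qT.
HB.instance Definition _ := Topological.on quot.
HB.instance Definition _ := Quotient.on quot.

Definition cls (x : T) : quot := (\pi_quot x)%qT.

End Quotient.

Arguments quot {T} r.
Arguments cls {T} r x.

(* f restricts to a homeomorphism from the subspace A onto the subspace B; the
   last clause is the continuity of the inverse bijection. *)
Definition homeo_on (S T : topologicalType) (f : S -> T) (A : set S)
    (B : set T) : Prop :=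
  [/\ set_bij A B f,
      {within A, continuous f} &
      forall V : set S, open V ->
        exists2 W : set T, open W & f @` (A `&` V) = B `&` W].

(** * The torus, its lattice and its automorphisms *)

Section Torus.
Variables (R : realType) (n : nat).

(* The alias ^o carries the topology given by the modulus. *)
Definition Cn : topologicalType := 'rV[R[i]^o]_n.

Definition S1 : topologicalType := set_type [set z : R[i]^o | `|z| = 1].

Definition S1_val (z : S1) : R[i] := set_val z.

Lemma S1_subproof (z : R[i]^o) : `|z| = 1 -> z \in [set z : R[i]^o | `|z| = 1].
Proof. by move=> z1; rewrite inE. Qed.

Definition S1_of (z : R[i]^o) (z1 : `|z| = 1) : S1 := exist _ z (S1_subproof z1).

Lemma S1P (z : S1) : `|S1_val z| = 1.
Proof. exact: (set_valP z). Qed.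

Lemma S1_mul_subproof (z w : S1) : `|S1_val z * S1_val w| = 1.
Proof. by rewrite normrM !S1P mulr1. Qed.

Lemma S1_inv_subproof (z : S1) : `|(S1_val z)^-1| = 1.
Proof. by rewrite normfV S1P invr1. Qed.

Lemma S1_exp_subproof (a : R) : `|(cos a +i* sin a)%C| = 1.
Proof. by rewrite normc_def /= cos2Dsin2 sqrtr1. Qed.

Definition S1_one : S1 := S1_of (normr1 R[i]).
Definition S1_mul (z w : S1) : S1 := S1_of (S1_mul_subproof z w).
Definition S1_inv (z : S1) : S1 := S1_of (S1_inv_subproof z).
Definition S1_exp (a : R) : S1 := S1_of (S1_exp_subproof a).

Definition torus : topologicalType := 'rV[S1]_n.

Definition tone : torus := \row_j S1_one.
Definition tmul (u v : torus) : torus := \row_j S1_mul (u 0 j) (v 0 j).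
Definition tinv (u : torus) : torus := \row_j S1_inv (u 0 j).

Definition tact (u : torus) (z : Cn) : Cn := \row_j (S1_val (u 0 j) * z 0 j).

Definition tinvariant (A : set Cn) : Prop := forall u z, A z -> A (tact u z).

Definition muC (z : Cn) : 'rV[R]_n :=
  \row_j (complex.Re (z 0 j) ^+ 2 + complex.Im (z 0 j) ^+ 2).

(* The Lie algebra is R^n, with exp normalized so that its kernel is Z^n. *)
Definition texp (xi : 'rV[R]_n) : torus := \row_j S1_exp (2 * pi * xi 0 j).

Definition lattice : topologicalType :=
  set_type [set xi : 'rV[R]_n | texp xi = tone].

Definition lattice_val (l : lattice) : 'rV[R]_n := set_val l.

Definition is_taut (f : torus -> torus) : Prop :=
  [/\ {morph f : u v / tmul u v}, continuous f &
      exists g : torus -> torus, [/\ cancel f g, cancel g f & continuous g]].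

Definition Taut : topologicalType := discrete_topology (set_type is_taut).

Definition taut_fun (g : Taut) : torus -> torus :=
  set_val (g : set_type is_taut).

Lemma is_taut_id : (id : torus -> torus) \in (is_taut : set _).
Proof.
rewrite inE; split => [//||]; first by move=> x.
by exists id; split => // x.
Qed.

Definition taut_id : Taut := exist _ (id : torus -> torus) is_taut_id.

(* k is the image of l under the element of GL(lattice) given by the
   differential of g at the unit. *)
Definition taut_differential (g : Taut) (l k : lattice) : Prop :=
  forall s : R, taut_fun g (texp (s *: lattice_val l)) =
                texp (s *: lattice_val k).

(* s |-> exp (s l) induces an isomorphism from R/Z onto the subset C of the
   torus. *)
Definition generates_circle (l : lattice) (C : set torus) : Prop :=
  C = range (fun s : R => texp (s *: lattice_val l)) /\
  (forall s : R, texp (s *: lattice_val l) = tone -> exists m : int, s = m%:~R).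

(* The subtorus generated by the elements of M is the image under exp of the
   real span of M. *)
Definition subtorus (M : set lattice) : set torus :=
  [set u | exists (m : nat) (l : 'I_m -> lattice) (s : 'I_m -> R),
    (forall j, M (l j)) /\ u = texp (\sum_(j < m) s j *: lattice_val (l j))].

End Torus.

(** * Weakly standard atlases *)

Section Atlas.
Variables (R : realType) (n : nat) (X : topologicalType).

Record chart := Chart {
  chart_dom : set X;
  chart_map :> X -> Cn R n;
  chart_dom_open : open chart_dom;
  chart_img_open : open (chart_map @` chart_dom);
  chart_img_invariant : tinvariant (chart_map @` chart_dom);
  chart_homeo : homeo_on chart_map chart_dom (chart_map @` chart_dom) }.

HB.instance Definition _ := gen_eqMixin chart.
HB.instance Definition _ := gen_choiceMixin chart.

Definition overlap (c d : chart) : set X := chart_dom c `&` chart_dom d.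

(* c o d^-1 is g-equivariant on d (overlap c d): with z = d x and u.z = d y
   this reads c (d^-1 (u.z)) = g(u).(c (d^-1 z)). *)
Definition transition_equivariant (c d : chart) (g : Taut R n) : Prop :=
  forall (u : torus R n) (x y : X), overlap c d x -> overlap c d y ->
    d y = tact u (d x) -> c y = tact (taut_fun g u) (c x).

(* c o d^-1 is automatically a homeomorphism, c and d being homeomorphisms
   onto open sets. *)
Definition compatible (c d : chart) : Prop :=
  overlap c d !=set0 ->
  [/\ tinvariant (c @` overlap c d), tinvariant (d @` overlap c d) &
      exists g, transition_equivariant c d g].

Record atlas := Atlas {
  atlas_charts : set chart;
  atlas_cover : forall x, exists2 c, atlas_charts c & chart_dom c x;
  atlas_compatible : forall c d, atlas_charts c -> atlas_charts d ->
    compatible c d;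
  atlas_connected : forall c d, atlas_charts c -> atlas_charts d -> c <> d ->
    connected (overlap c d) }.

Definition atlas_equiv (A A' : atlas) : Prop :=
  forall c d, atlas_charts A c -> atlas_charts A' d -> compatible c d.

Record local_action := LocalAction {
  local_action_atlases : set atlas;
  local_action_class : exists A,
    local_action_atlases = [set A' | atlas_equiv A A'] }.

End Atlas.

(** * The orbit space, the characteristic pair and the canonical model *)

Section Model.
Variables (R : realType) (n : nat) (X : topologicalType) (A : atlas R n X).

(* The index set of the atlas, its charts. *)
Definition index : Type := set_type (atlas_charts A).
HB.instance Definition _ := Choice.on index.
Definition chart_of (a : index) : chart R n X := set_val a.

Definition img (a : index) : set (Cn R n) := chart_of a @` chart_dom (chart_of a).

Definition orbit_rel (a : index) (z w : set_type (img a)) : Prop :=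
  exists u, set_val w = tact u (set_val z).

(* The space U^B_a, the quotient of the image of the chart a by the torus. *)
Definition local_orbit_space (a : index) : topologicalType :=
  quot (@orbit_rel a).

Definition orbit (a : index) (z : set_type (img a)) : local_orbit_space a :=
  cls (@orbit_rel a) z.

Definition glue_orbits (p q : {a : index & local_orbit_space a}) : Prop :=
  exists (a b : index) (x : X) (z : set_type (img a)) (w : set_type (img b)),
    [/\ overlap (chart_of a) (chart_of b) x, set_val z = chart_of a x, set_val w = chart_of b x,
        p = existT _ a (orbit z) & q = existT _ b (orbit w)].

Definition BX : topologicalType := quot glue_orbits.

Definition to_BX (a : index) (p : local_orbit_space a) : BX :=
  cls glue_orbits (existT _ a p).

(* U^B_a seen as a subset of BX. *)
Definition UB (a : index) : set BX := range (@to_BX a).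

Lemma index_cover (x : X) : exists a, chart_dom (chart_of a) x.
Proof.
have [c Ac cx] := atlas_cover A x.
by exists (exist _ c (mem_set Ac)).
Qed.

Lemma img_subproof (a : index) (x : X) :
  chart_dom (chart_of a) x -> chart_of a x \in img a.
Proof. by move=> ax; rewrite inE; exists x. Qed.

Definition muX (x : X) : BX :=
  let: exist a ax := cid (index_cover x) in
  to_BX (orbit (exist _ (chart_of a x) (img_subproof ax))).

(* The chart of BX on UB a induced by muC, computed on any element z of the
   orbit b. *)
Definition phiB (a : index) (b : BX) : 'rV[R]_n :=
  muC (xget 0 [set z : Cn R n |
    exists2 z' : set_type (img a), z = set_val z' & b = to_BX (orbit z')]).

Definition stratum (k : nat) : set BX :=
  [set b | exists2 a, UB a b & #|[pred i | phiB a b 0 i != 0]| = k].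

(* The (n-1)-dimensional stratum, empty when n = 0. *)
Definition facets : set BX := [set b | exists2 k, n = k.+1 & stratum k b].

Definition PX_chart (a : index) : topologicalType :=
  (set_type (UB a) * Taut R n)%type.

Definition glue_PX (p q : {a : index & PX_chart a}) : Prop :=
  exists (a b : index) (x : set_type (UB a)) (y : set_type (UB b))
         (g ha hb : Taut R n),
    [/\ set_val x = set_val y, transition_equivariant (chart_of a) (chart_of b) g,
        taut_fun ha = taut_fun g \o taut_fun hb,
        p = existT PX_chart a (x, ha) & q = existT PX_chart b (y, hb)].

Definition PX : topologicalType := quot glue_PX.

Definition to_PX (a : index) (x : set_type (UB a)) (h : Taut R n) : PX :=
  cls glue_PX (existT PX_chart a (x, h)).

Definition piP (p : PX) : BX := set_val (projT2 (repr p)).1.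

(* The bundle PX x_Aut F associated with a left action of Aut(T^n) on F, where
   act g f f' stands for f' = g f: it identifies (p g, f) with (p, g f). *)
Section AssociatedBundle.
Variables (F : topologicalType) (act : Taut R n -> F -> F -> Prop).

Definition assoc_rel (p q : (PX * F)%type) : Prop :=
  exists (a : index) (x : set_type (UB a)) (h g hg : Taut R n) (f f' : F),
    [/\ taut_fun hg = taut_fun h \o taut_fun g, act g f f',
        p = (to_PX x hg, f) & q = (to_PX x h, f')].

Definition assoc_bundle : topologicalType := quot assoc_rel.

(* The inverse of the trivialization over UB a. *)
Definition assoc_triv (a : index) (x : set_type (UB a)) (f : F) :
  assoc_bundle := cls assoc_rel (to_PX x (taut_id R n), f).

Definition assoc_proj (e : assoc_bundle) : BX := piP (repr e).1.

End AssociatedBundle.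

Definition LambdaX : topologicalType := assoc_bundle (@taut_differential R n).
Definition TX : topologicalType :=
  assoc_bundle (fun (g : Taut R n) t t' => t' = taut_fun g t).

Definition trivL (a : index) (x : set_type (UB a)) (l : lattice R n) :
  LambdaX := assoc_triv (@taut_differential R n) x l.
Definition trivT (a : index) (x : set_type (UB a)) (t : torus R n) : TX :=
  assoc_triv (fun (g : Taut R n) t t' => t' = taut_fun g t) x t.
Definition piT (t : TX) : BX := assoc_proj t.

(* The elements of the torus fixing the preimage under muC of the image under
   phiB a of the component of b in UB a `&` facets. *)
Definition component_stabilizer (a : index) (b : BX) : set (torus R n) :=
  [set u | forall z : Cn R n,
    (phiB a @` connected_component (UB a `&` facets) b) (muC z) ->
    tact u z = z].

Definition LX : set LambdaX :=
  [set e | exists (a : index) (x : set_type (UB a)) (l k : lattice R n)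
                  (m : int),
    [/\ facets (set_val x),
        generates_circle l (component_stabilizer a (set_val x)),
        lattice_val k = lattice_val l *~ m & e = trivL x k]].

(* In the trivialization over UB a, the rank one sublattices given by the local
   components near b of the (n-1)-dimensional stratum: those occurring as
   fibers of LX at points of that stratum arbitrarily close to b. *)
Definition local_sublattice (a : index) (b : BX) (L : set (lattice R n)) :
    Prop :=
  forall V : set BX, nbhs b V -> exists x : set_type (UB a),
    [/\ V (set_val x), facets (set_val x) & L = [set l | LX (trivL x l)]].

Definition ZX (b : BX) : set TX :=
  [set t | exists (a : index) (x : set_type (UB a)) (u : torus R n),
    [/\ set_val x = b, t = trivT x u &
        subtorus [set l | exists2 L, local_sublattice a b L & L l] u]].

Definition index_at (b : BX) : index := projT1 (repr b).

Lemma index_atP (b : BX) : b \in UB (index_at b).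
Proof.
rewrite inE; exists (projT2 (repr b)) => //.
by rewrite /to_BX /cls /index_at -sigT_eta reprK.
Qed.

Definition at_index (b : BX) : set_type (UB (index_at b)) :=
  exist _ b (index_atP b).

(* The group structure on the fibers of TX, read in the trivialization over
   some UB a containing the base point; it does not depend on a. *)
Definition TX_coord (a : index) (t : TX) : torus R n :=
  xget (tone R n) [set u | exists x : set_type (UB a), t = trivT x u].
Definition TX_one (b : BX) : TX := trivT (at_index b) (tone R n).
Definition TX_mul (t t' : TX) : TX :=
  let a := index_at (piT t) in
  trivT (at_index (piT t)) (tmul (TX_coord a t) (TX_coord a t')).
Definition TX_inv (t : TX) : TX :=
  trivT (at_index (piT t)) (tinv (TX_coord (index_at (piT t)) t)).

Definition model_rel (t t' : TX) : Prop :=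
  piT t = piT t' /\ ZX (piT t) (TX_mul t' (TX_inv t)).

(* The canonical model X_(PX,LX). *)
Definition XPL : topologicalType := quot model_rel.

Definition piXPL (x : XPL) : BX := piT (repr x).

(* The group structure on the fibers of the model. *)
Definition XPL_one (b : BX) : XPL := cls model_rel (TX_one b).
Definition XPL_mul (x y : XPL) : XPL :=
  cls model_rel (TX_mul (repr x) (repr y)).

(* The fiberwise actions of TX on the canonical model and on X, both meaningful
   for t and x over the same point of BX. *)
Definition TX_act_XPL (t : TX) (x : XPL) : XPL :=
  cls model_rel (TX_mul t (repr x)).
Definition TX_act_X (t : TX) (x : X) : X :=
  xget x [set y | exists (a : index) (b : set_type (UB a)) (u : torus R n),
    [/\ chart_dom (chart_of a) x, chart_dom (chart_of a) y, t = trivT b u &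
        chart_of a y = tact u (chart_of a x)]].

(** * The Euler class *)

(* A section over V of the sheaf of continuous sections of the model. *)
Definition sheaf_section (V : set BX) (s : BX -> XPL) : Prop :=
  {within V, continuous s} /\ (forall b, V b -> piXPL (s b) = b).

(* A Cech 1-cochain on a cover; its entry at j, k only matters over
   cov j `&` cov k. *)
Record cochain1 := Cochain1 {
  cov_index : Type;
  cov : cov_index -> set BX;
  cochain_val :> cov_index -> cov_index -> BX -> XPL }.

Definition open_cover (J : Type) (V : J -> set BX) : Prop :=
  (forall j, open (V j)) /\ (forall b, exists j, V j b).

Definition cocycle1 (c : cochain1) : Prop :=
  [/\ open_cover (@cov c),
      forall j k, sheaf_section (cov j `&` cov k) (c j k) &
      forall j k l b, cov j b -> cov k b -> cov l b ->
        XPL_mul (c j k b) (c k l b) = c j l b].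

(* c and d differ by a coboundary on some common refinement of their covers. *)
Definition cohomologous (c d : cochain1) : Prop :=
  exists (J : Type) (W : J -> set BX)
         (rc : J -> cov_index c) (rd : J -> cov_index d) (s : J -> BX -> XPL),
    [/\ open_cover W,
        forall j, W j `<=` cov (rc j) /\ W j `<=` cov (rd j),
        forall j, sheaf_section (W j) (s j) &
        forall j k b, W j b -> W k b ->
          XPL_mul (c (rc j) (rc k) b) (s k b) =
          XPL_mul (s j b) (d (rd j) (rd k) b)].

(* The element of H^1(BX; S), the direct limit over open covers, defined by a
   cocycle c, as the collection of the cocycles representing it (a predicate,
   as cochain1 is too large a type for set). *)
Definition H1_class (c : cochain1) : cochain1 -> Prop :=
  fun d => cocycle1 d /\ cohomologous c d.

Definition H1_zero : cochain1 -> Prop :=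
  H1_class (@Cochain1 unit (fun=> setT) (fun _ _ => XPL_one)).

(* Equivariance under TX is stronger than compatibility with the local torus
   actions: through a chart of X and the trivialization of TX over it, TX acts
   as the torus. *)
Definition local_iso (a : index) (h : X -> XPL) : Prop :=
  [/\ homeo_on h (muX @^-1` UB a) (piXPL @^-1` UB a),
      forall x, UB a (muX x) -> piXPL (h x) = muX x &
      forall t x, UB a (muX x) -> piT t = muX x ->
        h (TX_act_X t x) = TX_act_XPL t (h x)].

(* theta is the cocycle given by h_a (h_b^-1 x) = theta_ab(muX y) x, written at
   x = h_b y. *)
Definition euler_cocycle (h : index -> X -> XPL)
    (theta : index -> index -> BX -> XPL) : Prop :=
  cocycle1 (Cochain1 UB theta) /\
  (forall a b y, UB a (muX y) -> UB b (muX y) ->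
     h a y = XPL_mul (theta a b (muX y)) (h b y)).

Definition euler_class (h : index -> X -> XPL) : cochain1 -> Prop :=
  fun d => exists2 theta, euler_cocycle h theta &
    H1_class (Cochain1 UB theta) d.

End Model.

Arguments H1_zero {R n X} A _.

(* Main.v *)
Require Import Defs.
From mathcomp Require Import ring.

Set Implicit Arguments.
Unset Strict Implicit.
Unset Printing Implicit Defensive.

Local Open Scope classical_set_scope.
Local Open Scope ring_scope.

(** Over each chart domain X is identified with the canonical model, which is
  a bundle of abelian groups, by the maps h_a; these are equivariant, so on a
  fiber h_a and h_b differ by the translation theta_ab. Everything then follows
  the pattern of principal bundles.

  Given a global section s, every theta_ab(b) must be the quotient of
  h_a(s(b)) by h_b(s(b)). This formula does define a cocycle
  (section_cocycleP), and any Euler cocycle is the coboundary of the local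
  sections h_a o s (euler_cocycle_trivial); as being cohomologous is an
  equivalence relation, the class is zero. Conversely, if theta is the
  coboundary of local sections p_j of the model, the points h_j^-1(p_j(b)) of X
  agree for all j and form a continuous section (trivialization_section).

  Two facts about the model are needed. First, its fibers are abelian groups
  whose operations can be computed in any chart. The transition automorphism of
  two charts is determined on any nonempty saturated open set, because such a
  set contains points with free orbit (equivariant_on_inj); hence transitions
  compose as a cocycle (transition_comp) and the torus bundle has well-defined
  coordinates (trivT_inj, trivT_change). The relation defining the model is
  invariant under translations, so the operations descend (model_rel_clos).

  Second, products and inverses of continuous sections are continuous. The
  quotient map from the torus bundle to the model is not open over the
  boundary of the orbit space, so this does not come from the quotient
  topology. Instead, sections are transported to X by some h_a and read in the
  chart a, where the operation p r^-1 q becomes z1 z2 / z3 in each coordinate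
  (local_iso_heap). Here z1, z2 and z3 have the same modulus, which gives
  continuity where z3 vanishes (cvg_mul_div_norm). *)

(** * The torus and its standard representation *)

Section TorusGroup.
Variables (R : realType) (n : nat).
Implicit Types (u v w : torus R n) (z : Cn R n).

Lemma S1_val_inj : injective (@S1_val R).
Proof. exact: val_inj. Qed.

Lemma S1_val_neq0 (z : S1 R) : S1_val z != 0.
Proof. by rewrite -normr_eq0 S1P oner_eq0. Qed.

Lemma torusP u v : (forall j, S1_val (u 0 j) = S1_val (v 0 j)) -> u = v.
Proof. by move=> uv; apply/rowP => j; apply: S1_val_inj. Qed.

Lemma S1_val_mul (a b : S1 R) : S1_val (S1_mul a b) = S1_val a * S1_val b.
Proof. by []. Qed.

Lemma S1_val_inv (a : S1 R) : S1_val (S1_inv a) = (S1_val a)^-1.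
Proof. by []. Qed.

Lemma S1_val_one : S1_val (S1_one R) = 1.
Proof. by []. Qed.

Definition S1E := (S1_val_mul, S1_val_inv, S1_val_one).

Lemma tmulC u v : tmul u v = tmul v u.
Proof. by apply: torusP => j; rewrite !mxE !S1E mulrC. Qed.

Lemma tmulA u v w : tmul u (tmul v w) = tmul (tmul u v) w.
Proof. by apply: torusP => j; rewrite !mxE !S1E mulrA. Qed.

Lemma tmul1 u : tmul u (tone R n) = u.
Proof. by apply: torusP => j; rewrite !mxE !S1E mulr1. Qed.

Lemma tmulV u : tmul u (tinv u) = tone R n.
Proof. by apply: torusP => j; rewrite !mxE !S1E mulfV ?S1_val_neq0. Qed.

Lemma tinvM u v : tinv (tmul u v) = tmul (tinv u) (tinv v).
Proof. by apply: torusP => j; rewrite !mxE !S1E invfM. Qed.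

Lemma tinvK u : tinv (tinv u) = u.
Proof. by apply: torusP => j; rewrite !mxE !S1E invrK. Qed.

Lemma tact1 z : tact (tone R n) z = z.
Proof. by apply/rowP => j; rewrite !mxE S1E mul1r. Qed.

Lemma tactM u v z : tact (tmul u v) z = tact u (tact v z).
Proof. by apply/rowP => j; rewrite !mxE S1E mulrA. Qed.

Lemma tactK u : cancel (tact u) (tact (tinv u)).
Proof. by move=> z; rewrite -tactM tmulC tmulV tact1. Qed.

Lemma tact_free u v z : (forall j, z 0 j != 0) -> tact u z = tact v z -> u = v.
Proof.
move=> z0 /rowP uv; apply: torusP => j; have := uv j.
by rewrite !mxE => /mulIf; exact.
Qed.

End TorusGroup.

(** * Limits of vectors *)

Section RowTopology.

Lemma cvg_row (S : topologicalType) (m : nat) (I : Type) (F : set_system I)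
    {FF : Filter F} (f : I -> 'rV[S]_m) (l : 'rV[S]_m) :
  (forall j, f x 0 j @[x --> F] --> l 0 j) -> f x @[x --> F] --> l.
Proof.
move=> fl B [P lP PB].
apply: (@filterS _ F _ [set x | forall j, P 0 j (f x 0 j)]).
  by move=> x Px; apply: PB => i j; rewrite ord1.
by apply: filter_forall => j; exact: fl (lP 0 j).
Qed.

Lemma row_coord_continuous (S : topologicalType) (m : nat) (j : 'I_m) :
  continuous (fun z : 'rV[S]_m => z 0 j).
Proof.
move=> z B zB; exists (fun _ k => if k == j then B else setT) => [i k|w wB].
  by rewrite ord1; case: eqVneq => [->//|_]; exact: filterT.
by have := wB 0 j; rewrite eqxx.
Qed.

(** Translating by a small multiple of the vector with all coordinates one
  leaves the coordinate hyperplanes. *)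
Lemma open_free_point (K : numFieldType) (n : nat) (U : set 'rV[K^o]_n) :
  open U -> U !=set0 -> exists2 z, U z & forall j, z 0 j != 0.
Proof.
move=> oU [z Uz].
pose f (e : K^o) : 'rV[K^o]_n := \row_j (z 0 j + e).
have zc (j : 'I_n) : z 0 j + e @[e --> (0 : K^o)] --> z 0 j.
  rewrite -[X in _ --> X]addr0.
  by apply: (@cvgD _ _ _ (nbhs (0 : K^o))); [exact: cvg_cst | exact: cvg_id].
have fc : f e @[e --> (0 : K^o)] --> z.
  apply: (@cvg_row _ _ _ (nbhs (0 : K^o))) => j.
  by under eq_fun do rewrite mxE; exact: zc.
have Uf : \forall e \near (0 : K^o)^', U (f e).
  apply: (cvg_within (F := nbhs (0 : K^o))).
  by apply: fc; exact: open_nbhs_nbhs.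
have nz (j : 'I_n) : \forall e \near (0 : K^o)^', z 0 j + e != 0.
  have [->|zj0] := eqVneq (z 0 j) 0.
    by near=> e; rewrite add0r; near: e; exact: nbhs_dnbhs_neq.
  apply: (cvg_within (F := nbhs (0 : K^o))).
  exact: (cvgr_neq0 (F := nbhs (0 : K^o)) _ (zc j)).
have PF : ProperFilter ((0 : K^o)^') by exact: Proper_dnbhs_numFieldType.
have nzU : \forall e \near (0 : K^o)^', forall j, z 0 j + e != 0.
  exact: filter_forall.
have [e [Ue ze]] := filter_ex (filterI Uf nzU).
by exists (f e) => // j; rewrite mxE.
Unshelve. all: by end_near.
Qed.

(** Where c vanishes so do a and b, and the quotient is squeezed by the norm
  of a. *)
Lemma cvg_mul_div_norm (K : numFieldType) (I : Type) (F : set_system I)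
    {FF : Filter F} (a b c : I -> K^o) (a0 b0 c0 : K^o) :
  (\forall x \near F, `|a x| = `|c x| /\ `|b x| = `|c x|) ->
  `|a0| = `|c0| ->
  a x @[x --> F] --> a0 -> b x @[x --> F] --> b0 -> c x @[x --> F] --> c0 ->
  a x * b x / c x @[x --> F] --> a0 * b0 / c0.
Proof.
move=> abc ac0 aa0 bb0 cc0.
have [c00|c0N0] := eqVneq c0 0; last first.
  by apply: cvgM; [apply: cvgM|apply: cvgV].
have a00 : a0 = 0 by apply/eqP; rewrite -normr_eq0 ac0 c00 normr0.
rewrite a00 !mul0r; rewrite a00 in aa0.
apply/cvgr0Pnorm_lt => e e0.
move/cvgr0Pnorm_lt : aa0 => /(_ e e0).
apply: filterS2 abc => x [ac bc] ale.
apply: le_lt_trans ale.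
rewrite !normrM bc normfV.
have [->|cx0] := eqVneq (c x) 0; first by rewrite normr0 mulr0 mul0r normr_ge0.
by rewrite mulfK ?normr_eq0.
Qed.

End RowTopology.

(** * Transition automorphisms and the orbit space *)

Section HomeoOn.
Variables (S T : topologicalType) (f : S -> T) (A : set S) (B : set T).
Hypothesis fAB : homeo_on f A B.

Lemma homeo_on_fun x : A x -> B (f x).
Proof. by move=> Ax; have [[fB _ _] _ _] := fAB; apply: fB. Qed.

Lemma homeo_on_inj x y : A x -> A y -> f x = f y -> x = y.
Proof.
by move=> Ax Ay; have [[_ inj _] _ _] := fAB; apply: inj; rewrite inE.
Qed.

Lemma homeo_on_surj t : B t -> exists2 x, A x & f x = t.
Proof. by have [[_ _ surj] _ _] := fAB => /surj [x Ax <-]; exists x. Qed.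

Lemma homeo_on_cvg (I : Type) (F : set_system I) {FF : Filter F}
    (g : I -> S) l :
  A l -> (\forall i \near F, A (g i)) ->
  g i @[i --> F] --> l -> f (g i) @[i --> F] --> f l.
Proof.
move=> Al Ag gl.
have [_ /subspace_continuousP /(_ l Al) fc _] := fAB.
move=> V /fc fV; rewrite /nbhs /=.
have : F (fun i => A (g i) -> V (f (g i))) by exact: gl fV.
by apply: filterS2 Ag => i Ai; apply.
Qed.

(** By the last clause of homeo_on, an open neighborhood of l in A is carried
  onto a relative neighborhood of f l in B. *)
Lemma homeo_on_cvg_inv (I : Type) (F : set_system I) {FF : Filter F}
    (g : I -> S) l :
  A l -> (\forall i \near F, A (g i)) ->
  f (g i) @[i --> F] --> f l -> g i @[i --> F] --> l.
Proof.
move=> Al Ag fgl V; rewrite nbhsE => -[U [oU Ul] UV]; rewrite /nbhs /=.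
have [_ _ /(_ U oU) [W oW fAU]] := fAB.
have Wl : W (f l).
  suff : (B `&` W) (f l) by case.
  by rewrite -fAU; exists l.
have FW : F (fun i => W (f (g i))) by apply: fgl; exact: open_nbhs_nbhs.
apply: filterS2 Ag FW => i Ai Wi; apply: UV.
have : (B `&` W) (f (g i)) by split => //; exact: homeo_on_fun.
by rewrite -fAU => -[x [Ax Ux] /(homeo_on_inj Ax Ai) <-].
Qed.

Lemma homeo_on_image_open U : open B -> open U -> U `<=` A -> open (f @` U).
Proof.
move=> oB oU UA; have [_ _ /(_ U oU) [W oW]] := fAB.
by rewrite setIidr // => ->; exact: openI.
Qed.

End HomeoOn.

Section Transitions.
Variables (R : realType) (n : nat) (X : topologicalType).
Implicit Types (c d e : chart R n X) (g : torus R n -> torus R n).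

Definition equivariant_on (D : set X) c d g :=
  forall u x y, D x -> D y -> d y = tact u (d x) -> c y = tact (g u) (c x).

Lemma chart_inj c x y : chart_dom c x -> chart_dom c y -> c x = c y -> x = y.
Proof. by move=> cx cy; exact: (homeo_on_inj (chart_homeo c)). Qed.

Lemma chart_act c x u : chart_dom c x ->
  exists2 y, chart_dom c y & c y = tact u (c x).
Proof.
move=> cx; have [|y cy <-] := @chart_img_invariant _ _ _ c u (c x).
  by exists x.
by exists y.
Qed.

Lemma is_taut_tone g : is_taut g -> g (tone R n) = tone R n.
Proof.
move=> [gM _ _]; have := gM (tone R n) (tone R n).
rewrite tmul1 => /(congr1 (tmul (tinv (g (tone R n))))).
by rewrite tmulA ![tmul (tinv _) _]tmulC tmulV [RHS]tmulC tmul1.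
Qed.

Lemma flip_unit_subproof : `|(-1 : R[i]^o)| = 1.
Proof. by rewrite normrN normr1. Qed.

(** If c x had a vanishing j-th coordinate, it would be fixed by the element w
  with entry -1 at j and 1 elsewhere; then the preimage of w under g, which is
  not the unit, would fix d x, whose orbit is free. *)
Lemma free_transition (D : set X) c d g x : is_taut g ->
  D `<=` overlap c d -> equivariant_on D c d g ->
  (forall u y, chart_dom d y -> d y = tact u (d x) -> D y) ->
  D x -> (forall j, d x 0 j != 0) -> forall j, c x 0 j != 0.
Proof.
move=> gT Dcd cdg Dsat Dx dx0 j; apply/eqP => cxj.
have [_ _ [g' [gK g'K _]]] := gT.
pose w : torus R n :=
  \row_k (if k == j then S1_of flip_unit_subproof else S1_one R).
have wx : tact w (c x) = c x.
  apply/rowP => k; rewrite !mxE; case: eqVneq => [->|_].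
    by rewrite cxj mulr0.
  by rewrite S1_val_one mul1r.
have [y dy dyE] := chart_act (g' w) (Dcd _ Dx).2.
have Dy := Dsat _ _ dy dyE.
have := cdg _ _ _ Dx Dy dyE; rewrite g'K wx.
move=> /(chart_inj (Dcd _ Dy).1 (Dcd _ Dx).1) yx.
have g'w1 : g' w = tone R n.
  by apply: (tact_free dx0); rewrite tact1 -dyE yx.
have : w = tone R n by rewrite -(g'K w) g'w1 (is_taut_tone gT).
move/rowP => /(_ j); rewrite !mxE eqxx => /(congr1 (@S1_val R)) /= /eqP.
rewrite /S1_val /= eq_sym -subr_eq0 opprK -(natrD _ 1 1) pnatr_eq0 //.
Qed.

(** Equivariance at one free orbit determines the automorphism, and the image
  of D, being open, meets a free orbit. *)
Lemma equivariant_on_inj (D : set X) c d g g' : is_taut g ->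
  open D -> D !=set0 -> D `<=` overlap c d ->
  (forall u x y, D x -> chart_dom d y -> d y = tact u (d x) -> D y) ->
  equivariant_on D c d g -> equivariant_on D c d g' -> g = g'.
Proof.
move=> gT oD [x0 Dx0] Dcd Dsat cdg cdg'.
have oI : open (d @` D).
  apply: (homeo_on_image_open (chart_homeo d) (@chart_img_open _ _ _ d) oD).
  by move=> x /Dcd [].
have [|z [x Dx <-] dx0] := open_free_point oI; first by exists (d x0), x0.
have cx0 := free_transition gT Dcd cdg (fun u y => @Dsat u x y Dx) Dx dx0.
apply/funext => u; have [y dy dyE] := chart_act u (Dcd _ Dx).2.
have Dy := Dsat _ _ _ Dx dy dyE.
apply: (tact_free cx0).
by rewrite -(cdg _ _ _ Dx Dy dyE) -(cdg' _ _ _ Dx Dy dyE).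
Qed.

Variable A : atlas R n X.
Implicit Types (a b k : index A).

Notation dom a := (chart_dom (chart_of a)).

Lemma index_compatible a b : compatible (chart_of a) (chart_of b).
Proof. by apply: atlas_compatible; exact: set_valP. Qed.

(** Overlaps are saturated: a domain that contains a point contains its orbit
  as seen in any other chart. *)
Lemma dom_orbit a b x y u : dom a x -> dom b x -> dom a y ->
  chart_of a y = tact u (chart_of a x) -> dom b y.
Proof.
move=> ax bx ay yE.
have [|inva _ _] := @index_compatible a b; first by exists x.
have : (chart_of a @` overlap (chart_of a) (chart_of b)) (chart_of a y).
  by rewrite yE; apply: inva; exists x.
by move=> [z [az bz] /(chart_inj az ay) <-].
Qed.

Definition transition a b : Taut R n :=
  xget (taut_id R n)
    [set g | transition_equivariant (chart_of a) (chart_of b) g].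

Lemma taut_funP (g : Taut R n) : is_taut (taut_fun g).
Proof. exact: set_valP. Qed.

Lemma transitionP a b x : dom a x -> dom b x ->
  transition_equivariant (chart_of a) (chart_of b) (transition a b).
Proof.
move=> ax bx; rewrite /transition; case: xgetP => [g -> //|H].
have [|_ _ [g cdg]] := @index_compatible a b; first by exists x.
by have := H g cdg.
Qed.

Lemma transition_act a b u x y : dom a x -> dom b x -> dom b y ->
  chart_of b y = tact u (chart_of b x) ->
  chart_of a y = tact (taut_fun (transition a b) u) (chart_of a x).
Proof.
move=> ax bx by_ yE; apply: (transitionP ax bx) => //.
by split => //; exact: dom_orbit bx ax by_ yE.
Qed.

Lemma transition_unique a b x (g : Taut R n) : dom a x -> dom b x ->
  transition_equivariant (chart_of a) (chart_of b) g ->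
  taut_fun g = taut_fun (transition a b).
Proof.
move=> ax bx abg.
apply: (@equivariant_on_inj (overlap (chart_of a) (chart_of b))
  (chart_of a) (chart_of b)) => //.
- exact: taut_funP.
- by apply: openI; exact: (@chart_dom_open _ _ _ _).
- by exists x.
- move=> u x' y [ax' bx'] by_ yE.
  by split => //; exact: dom_orbit bx' ax' by_ yE.
- exact: transitionP ax bx.
Qed.

(** Both sides are equivariant on the triple overlap, which is enough to
  identify them. *)
Lemma transition_comp a b k x : dom a x -> dom b x -> dom k x ->
  taut_fun (transition a k) =
  taut_fun (transition a b) \o taut_fun (transition b k).
Proof.
move=> ax bx kx.
apply: (@equivariant_on_inj (dom a `&` dom b `&` dom k)
  (chart_of a) (chart_of k)) => //.
- exact: taut_funP.
- by apply: openI; [apply: openI|]; exact: (@chart_dom_open _ _ _ _).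
- by exists x.
- by move=> ? [[]].
- move=> u x' y [[ax' bx'] kx'] ky yE.
  split => //.
  by split; [exact: dom_orbit kx' ax' ky yE|exact: dom_orbit kx' bx' ky yE].
- by move=> u x' y [[ax' bx'] kx'] [[ay by_] ky]; exact: transition_act.
- move=> u x' y [[ax' bx'] kx'] [[ay by_] ky] yE /=.
  by do 2?apply: transition_act => //.
Qed.

Lemma transition_id a x : dom a x -> taut_fun (transition a a) = id.
Proof.
move=> ax; symmetry; apply: (@transition_unique a a x (taut_id R n)) => //.
Qed.

End Transitions.

Section QuotientClasses.
Variables (T : topologicalType) (r : T -> T -> Prop).

Lemma cls_eqP x y : cls r x = cls r y <-> clos_refl_sym_trans T r x y.
Proof.
split=> [|xy]; first by move/(@eqmodP _ (gen_equiv_equiv r) x y)/asboolP.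
by apply/(@eqmodP _ (gen_equiv_equiv r) x y)/asboolP.
Qed.

Lemma cls_rel x y : r x y -> cls r x = cls r y.
Proof. by move=> xy; apply/cls_eqP; exact: rst_step. Qed.

Lemma cls_continuous : continuous (cls r).
Proof. exact: pi_continuous. Qed.

Lemma cls_repr (q : quot r) : cls r (repr q) = q.
Proof. exact: reprK. Qed.

Lemma repr_cls x : clos_refl_sym_trans T r (repr (cls r x)) x.
Proof. by apply/cls_eqP; rewrite cls_repr. Qed.

Lemma clos_invariant (V : Type) (f : T -> V) :
  (forall x y, r x y -> f x = f y) ->
  forall x y, clos_refl_sym_trans T r x y -> f x = f y.
Proof. by move=> rf x y; elim=> // x' y' z' _ -> _ ->. Qed.

Lemma cls_invariant (V : Type) (f : T -> V) :
  (forall x y, r x y -> f x = f y) -> forall x, f (repr (cls r x)) = f x.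
Proof. by move=> rf x; apply: clos_invariant rf _ _ (repr_cls x). Qed.

End QuotientClasses.

Section OrbitSpace.
Variables (R : realType) (n : nat) (X : topologicalType) (A : atlas R n X).
Implicit Types (a b k : index A).

Notation dom a := (chart_dom (chart_of a)).

Definition img_pt a x (ax : dom a x) : set_type (img a) :=
  exist _ (chart_of a x) (img_subproof ax).

Lemma img_ptP a (z : set_type (img a)) :
  exists x (ax : dom a x), z = img_pt ax.
Proof.
have [x ax xz] := set_valP z.
by exists x, ax; apply: val_inj; rewrite /= -xz.
Qed.

Lemma orbit_eqP a (z w : set_type (img a)) :
  orbit z = orbit w <-> exists u, set_val w = tact u (set_val z).
Proof.
split=> [/cls_eqP|zw]; last exact: cls_rel.
elim=> // [x|x y _ [u ->]|x y k _ [u xy] _ [v yk]].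
- by exists (tone R n); rewrite tact1.
- by exists (tinv u); rewrite tactK.
- by exists (tmul v u); rewrite tactM -xy.
Qed.

(** The orbit in X represented by p. It is constant on the classes of the
  gluing relation, so that equality in the glued space can be tested in X. *)
Definition orbit_set (p : {a : index A & local_orbit_space a}) : set X :=
  [set x | exists ax : dom (projT1 p) x, projT2 p = orbit (img_pt ax)].

Lemma glue_orbit_set p q : glue_orbits p q -> orbit_set p = orbit_set q.
Proof.
have sub a b x (ax : dom a x) (bx : dom b x) :
    orbit_set (existT _ a (orbit (img_pt ax))) `<=`
    orbit_set (existT _ b (orbit (img_pt bx))).
  move=> y [/= ay /orbit_eqP [u /= yE]].
  have by_ := dom_orbit ax bx ay yE.
  exists by_; apply/orbit_eqP; exists (taut_fun (transition b a) u).
  exact: transition_act yE.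
move=> [a [b [x [z [w [[ax bx] zE wE -> ->]]]]]].
rewrite (_ : z = img_pt ax); last exact: val_inj.
rewrite (_ : w = img_pt bx); last exact: val_inj.
by apply/seteqP; split; exact: sub.
Qed.

Lemma muXE a x (ax : dom a x) : muX A x = to_BX (orbit (img_pt ax)).
Proof.
rewrite /muX; case: cid => b bx; apply: cls_rel.
by exists b, a, x, (img_pt bx), (img_pt ax).
Qed.

(** The fibers of the orbit map are exactly the orbits, in any chart. *)
Lemma muX_orbit a x y : dom a x -> muX A x = muX A y ->
  dom a y /\ exists u, chart_of a y = tact u (chart_of a x).
Proof.
move=> ax; rewrite (muXE ax).
have [b by_] := index_cover A y.
rewrite (muXE by_) => /cls_eqP /(clos_invariant glue_orbit_set) xy.
have : orbit_set (existT _ b (orbit (img_pt by_))) y by exists by_.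
by rewrite -xy => -[ay /orbit_eqP].
Qed.

Lemma UB_pt a (b : BX A) : UB a b -> exists2 x, dom a x & muX A x = b.
Proof.
case=> o _ <-; have [x [ax xo]] := img_ptP (repr o).
by exists x => //; rewrite (muXE ax) -xo /orbit cls_repr.
Qed.

Lemma UB_muX a x : UB a (muX A x) <-> dom a x.
Proof.
split=> [/UB_pt [y ay /(muX_orbit ay) []//]|ax].
by rewrite (muXE ax); eexists.
Qed.

Lemma UB_cover (b : BX A) : exists a, @UB R n X A a b.
Proof. by exists (index_at b); exact: set_mem (index_atP b). Qed.

Lemma UB_open a : open (@UB R n X A a).
Proof.
apply/sigT_openP => b.
pose U := chart_of b @` overlap (chart_of a) (chart_of b).
have oU : open U.
  apply: (homeo_on_image_open (chart_homeo (chart_of b))).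
  - exact: (@chart_img_open _ _ _ _).
  - by apply: openI; exact: (@chart_dom_open _ _ _ _).
  - by move=> x [].
rewrite /open /= /quotient_open.
rewrite (_ : _ @^-1` _ = (set_val : set_type (img b) -> Cn R n) @^-1` U).
  by exists U.
apply/seteqP; split => z; have [x [bx ->]] := img_ptP z.
  move=> /= H; exists x => //; split=> //; apply/UB_muX.
  by rewrite (muXE bx).
move=> [y [ay by_] /(chart_inj by_ bx) yx]; subst y.
have := (UB_muX a x).2 ay; by rewrite (muXE bx).
Qed.

End OrbitSpace.

(** * The torus bundle *)

Section TorusBundle.
Variables (R : realType) (n : nat) (X : topologicalType) (A : atlas R n X).
Implicit Types (a b k : index A).

Notation dom a := (chart_dom (chart_of a)).
Notation tau a b := (taut_fun (transition a b)).

Definition glue_PX_base (p : {a : index A & PX_chart a}) : BX A :=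
  set_val (projT2 p).1.

(** The component in Aut(T^n) of a point of PX, read in the chart a: this is
  meaningful when its base point lies over a. *)
Definition glue_PX_coord a (p : {a : index A & PX_chart a}) :
  torus R n -> torus R n := tau a (projT1 p) \o taut_fun (projT2 p).2.

Lemma UB_common a b (p : BX A) : UB a p -> UB b p ->
  exists x, [/\ dom a x, dom b x & muX A x = p].
Proof. by move=> /UB_pt [x ax <-] /UB_muX bx; exists x. Qed.

Lemma glue_PX_base_eq p q : glue_PX p q -> glue_PX_base p = glue_PX_base q.
Proof. by move=> [a [b [x [y [g [ha [hb [xy _ _ -> ->]]]]]]]]. Qed.

Lemma glue_PX_coord_eq k p q : glue_PX p q -> UB k (glue_PX_base p) ->
  glue_PX_coord k p = glue_PX_coord k q.
Proof.
move=> [a [b [x [y [g [ha [hb [xy ag hab -> ->]]]]]]]] kx.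
have ax : UB a (set_val x) by exact: set_valP.
have by_ : UB b (set_val x) by rewrite xy; exact: set_valP.
have [z [az bz zx]] := UB_common ax by_.
have kz : dom k z by apply/UB_muX; rewrite zx.
rewrite /glue_PX_coord /= hab (transition_unique az bz ag).
by rewrite (transition_comp kz az bz).
Qed.

Lemma glue_PX_clos k p q :
  clos_refl_sym_trans _ (@glue_PX R n X A) p q -> UB k (glue_PX_base p) ->
  glue_PX_coord k p = glue_PX_coord k q.
Proof.
have base := clos_invariant (@glue_PX_base_eq).
elim=> {p q} [p q|//|p q pq IH|p q s pq IHp qs IHq].
- exact: glue_PX_coord_eq.
- by move=> kq; rewrite IH // (base _ _ pq).
- by move=> kp; rewrite IHp // IHq // -(base _ _ pq).
Qed.

Lemma piP_to_PX a (x : set_type (UB a)) h : piP (to_PX x h) = set_val x.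
Proof.
exact: (cls_invariant (f := glue_PX_base) glue_PX_base_eq (existT _ a (x, h))).
Qed.

Lemma to_PX_surj (p : PX A) : exists a (x : set_type (UB a)) h, p = to_PX x h.
Proof.
rewrite -(cls_repr p); case: (repr p) => a [x h].
by exists a, x, h.
Qed.

Definition PX_coord k (p : PX A) := glue_PX_coord k (repr p).

Lemma PX_coord_to_PX k a (x : set_type (UB a)) h : UB k (set_val x) ->
  PX_coord k (to_PX x h) = tau k a \o taut_fun h.
Proof.
move=> kx; symmetry.
apply: (@glue_PX_clos k (existT (@PX_chart R n X A) a (x, h))) => //.
by apply: rst_sym; exact: repr_cls.
Qed.

Lemma to_PX_change a b (x : set_type (UB a)) (y : set_type (UB b)) :
  set_val x = set_val y -> to_PX y (taut_id R n) = to_PX x (transition a b).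
Proof.
move=> xy; have ax : UB a (set_val x) by exact: set_valP.
have by_ : UB b (set_val x) by rewrite xy; exact: set_valP.
have [z [az bz _]] := UB_common ax by_.
apply/esym/cls_rel; exists a, b, x, y.
exists (transition a b), (transition a b), (taut_id R n).
by split => //; exact: transitionP az bz.
Qed.

Local Notation taut_act :=
  (fun (g : Taut R n) (t t' : torus R n) => t' = taut_fun g t).
Local Notation TXrel := (@assoc_rel R n X A _ taut_act).

Lemma TXrel_base p q : TXrel p q -> piP p.1 = piP q.1.
Proof.
by move=> [a [x [h [g [hg [f [f' [_ _ -> ->]]]]]]]]; rewrite !piP_to_PX.
Qed.

Lemma TXrel_coord k p q : TXrel p q -> UB k (piP p.1) ->
  PX_coord k p.1 p.2 = PX_coord k q.1 q.2.
Proof.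
move=> [a [x [h [g [hg [f [f' [hgE -> -> ->]]]]]]]]; rewrite piP_to_PX => kx.
by rewrite !PX_coord_to_PX //= hgE.
Qed.

Lemma TXrel_clos k p q : clos_refl_sym_trans _ TXrel p q -> UB k (piP p.1) ->
  PX_coord k p.1 p.2 = PX_coord k q.1 q.2.
Proof.
have base := clos_invariant TXrel_base.
elim=> {p q} [p q|//|p q pq IH|p q s pq IHp qs IHq].
- exact: TXrel_coord.
- by move=> kq; rewrite IH // (base _ _ pq).
- by move=> kp; rewrite IHp // IHq // -(base _ _ pq).
Qed.

Lemma piT_trivT a (x : set_type (UB a)) u : piT (trivT x u) = set_val x.
Proof.
have := cls_invariant TXrel_base (to_PX x (taut_id R n), u).
by rewrite piP_to_PX.
Qed.

(** Reading a class (p, f) in the chart a as the coordinate of p applied to f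
  gives the same result on related pairs, hence separates the points of the
  fiber. *)
Lemma trivT_inj a (x : set_type (UB a)) : injective (trivT x).
Proof.
move=> u v /cls_eqP /(@TXrel_clos a) /=; rewrite piP_to_PX.
have ax : UB a (set_val x) by exact: set_valP.
move=> /(_ ax); rewrite PX_coord_to_PX //=.
have [z az _] := UB_pt ax.
by rewrite (transition_id az).
Qed.

Lemma trivT_change a b (x : set_type (UB a)) (y : set_type (UB b)) u :
  set_val x = set_val y -> trivT y u = trivT x (tau a b u).
Proof.
move=> xy; rewrite /trivT /assoc_triv (to_PX_change xy).
apply: cls_rel; exists a, x, (taut_id R n), (transition a b), (transition a b).
exists u, (tau a b u).
by split.
Qed.

Lemma trivT_surj a (t : TX A) : UB a (piT t) ->
  exists (x : set_type (UB a)) u, t = trivT x u.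
Proof.
rewrite -(cls_repr t); case: (repr t) => p f.
have [b [y [h ->]]] := to_PX_surj p.
have -> : cls TXrel (to_PX y h, f) = trivT y (taut_fun h f).
  apply: cls_rel; exists b, y, (taut_id R n), h, h, f, (taut_fun h f).
  by split.
rewrite piT_trivT => ay.
exists (exist _ (set_val y) (mem_set ay)), (tau a b (taut_fun h f)).
exact: trivT_change.
Qed.

Lemma TX_coord_trivT a (x : set_type (UB a)) u : TX_coord a (trivT x u) = u.
Proof.
rewrite /TX_coord; case: xgetP => [v _ [y]|/(_ u) []]; last by exists x.
move=> xy; have yx : y = x.
  by apply: val_inj; rewrite /= -[LHS](piT_trivT y v) -xy piT_trivT.
by apply: (@trivT_inj _ x); rewrite xy yx.
Qed.

Lemma taut_tmul (g : Taut R n) u v :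
  taut_fun g (tmul u v) = tmul (taut_fun g u) (taut_fun g v).
Proof. by have [gM _ _] := taut_funP g. Qed.

Lemma taut_tinv (g : Taut R n) u : taut_fun g (tinv u) = tinv (taut_fun g u).
Proof.
rewrite -[LHS]tmul1 -(tmulV (taut_fun g u)) tmulA -taut_tmul.
rewrite [tmul (tinv u) u]tmulC tmulV.
by rewrite (is_taut_tone (taut_funP g)) tmulC tmul1.
Qed.

(** The operations of the fibers, defined through a chosen chart, are those of
  the torus in every chart since the transition maps are automorphisms. *)
Lemma TX_mul_trivT a (x : set_type (UB a)) u v :
  TX_mul (trivT x u) (trivT x v) = trivT x (tmul u v).
Proof.
rewrite /TX_mul piT_trivT; set y := at_index _.
have xy : set_val y = set_val x by [].
by rewrite !(trivT_change _ xy) !TX_coord_trivT taut_tmul.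
Qed.

Lemma TX_inv_trivT a (x : set_type (UB a)) u :
  TX_inv (trivT x u) = trivT x (tinv u).
Proof.
rewrite /TX_inv piT_trivT; set y := at_index _.
have xy : set_val y = set_val x by [].
by rewrite !(trivT_change _ xy) !TX_coord_trivT taut_tinv.
Qed.

Lemma TX_one_trivT a (x : set_type (UB a)) :
  TX_one (set_val x) = trivT x (tone R n).
Proof.
have xy : set_val (at_index (set_val x)) = set_val x by [].
by rewrite (trivT_change _ xy) (is_taut_tone (taut_funP _)).
Qed.

Lemma trivT_continuous a u :
  continuous (fun x : set_type (@UB R n X A a) => trivT x u).
Proof.
have pairc (S T : topologicalType) (f : set_type (@UB R n X A a) -> S) (y : T) :
    continuous f -> continuous (fun x => (f x, y)).
  by move=> fc x; apply: (cvg_pair (fc x)); exact: cvg_cst.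
have to_PXc :
    continuous (fun x : set_type (@UB R n X A a) => to_PX x (taut_id R n)).
  move=> x; apply: (continuous_comp (g := cls (@glue_PX R n X A))
    (f := fun x => existT (@PX_chart R n X A) a (x, taut_id R n))).
    apply: (continuous_comp (g := existT (@PX_chart R n X A) a)
      (f := fun x => (x, taut_id R n))).
      by apply: (pairc _ _ id) => y; exact: cvg_id.
    exact: existT_continuous.
  exact: cls_continuous.
move=> x; apply: (continuous_comp (g := cls TXrel)
  (f := fun x => (to_PX x (taut_id R n), u))).
  exact: pairc.
exact: cls_continuous.
Qed.

End TorusBundle.

(** * The canonical model as a bundle of abelian groups *)

Section Model.
Variables (R : realType) (n : nat) (X : topologicalType) (A : atlas R n X).
Implicit Types (a : index A) (p q r : XPL A).

Notation dom a := (chart_dom (chart_of a)).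
Local Notation mrel := (@model_rel R n X A).

Definition XPL_pt a (x : set_type (UB a)) (u : torus R n) : XPL A :=
  cls mrel (trivT x u).

Lemma model_rel_base (t t' : TX A) : mrel t t' -> piT t = piT t'.
Proof. by case. Qed.

Lemma piXPL_cls (t : TX A) : piXPL (cls mrel t) = piT t.
Proof. exact: (cls_invariant model_rel_base). Qed.

Lemma piXPL_pt a (x : set_type (UB a)) u : piXPL (XPL_pt x u) = set_val x.
Proof. by rewrite piXPL_cls piT_trivT. Qed.

Lemma trivT_over a (x : set_type (UB a)) (t : TX A) : piT t = set_val x ->
  exists u, t = trivT x u.
Proof.
move=> tx; have [|y [u tE]] := @trivT_surj _ _ _ _ a t.
  by rewrite tx; exact: set_valP.
exists u; rewrite tE; congr trivT; apply: val_inj; rewrite /= -[RHS]tx.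
by rewrite tE piT_trivT.
Qed.

Lemma XPL_over a (x : set_type (UB a)) q : piXPL q = set_val x ->
  exists u, q = XPL_pt x u.
Proof.
rewrite -(cls_repr q) piXPL_cls => /trivT_over [u ->].
by exists u.
Qed.

(** Translating t and t' by the same element does not change the quotient
  t' t^-1, and inverting both t and t' turns it into the quotient for the
  converse relation. So the generated equivalence is a congruence for the
  operations of the fibers, which therefore descend to the model. *)
Lemma model_rel_clos (t t' : TX A) : clos_refl_sym_trans _ mrel t t' ->
  forall a (x : set_type (UB a)) u v, t = trivT x u -> t' = trivT x v ->
  (forall w, XPL_pt x (tmul w u) = XPL_pt x (tmul w v)) /\
  XPL_pt x (tinv u) = XPL_pt x (tinv v).
Proof.
have base := clos_invariant model_rel_base.
elim=> {t t'}.
- move=> t t' tt' a x u v tE t'E; subst t t'.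
  case: tt' => _; rewrite piT_trivT TX_inv_trivT TX_mul_trivT => Z.
  split=> [w|].
  + apply: cls_rel; split; rewrite !piT_trivT // TX_inv_trivT TX_mul_trivT.
    rewrite tinvM -tmulA [tmul v _]tmulC -tmulA [tmul _ v]tmulC tmulA tmulV.
    by rewrite tmulC tmul1.
  + apply/esym/cls_rel; split; rewrite !piT_trivT // TX_inv_trivT TX_mul_trivT.
    by rewrite tinvK tmulC.
- by move=> t a x u v -> /trivT_inj ->.
- move=> t t' tt' IH a x u v tE t'E.
  by have [IH1 IH2] := IH a x v u t'E tE; split=> [w|]; rewrite ?IH1 ?IH2.
- move=> s t t' st IHst tt' IHtt' a x u v sE t'E.
  have [|w tE] := @trivT_over a x t.
    by rewrite -(base _ _ st) sE piT_trivT.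
  have [A1 A2] := IHst a x u w sE tE; have [B1 B2] := IHtt' a x w v tE t'E.
  by split=> [z|]; rewrite ?A1 ?A2 ?B1 ?B2.
Qed.

Lemma repr_XPL_pt a (x : set_type (UB a)) u : exists v,
  [/\ repr (XPL_pt x u) = trivT x v,
      forall w, XPL_pt x (tmul w v) = XPL_pt x (tmul w u) &
      XPL_pt x (tinv v) = XPL_pt x (tinv u)].
Proof.
have [|v vE] := @trivT_over a x (repr (XPL_pt x u)); first exact: piXPL_pt.
have [vu1 vu2] := model_rel_clos (@repr_cls _ mrel (trivT x u)) vE erefl.
by exists v.
Qed.

Lemma XPL_mul_pt a (x : set_type (UB a)) u v :
  XPL_mul (XPL_pt x u) (XPL_pt x v) = XPL_pt x (tmul u v).
Proof.
have [u' [uE u'u _]] := repr_XPL_pt x u.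
have [v' [vE v'v _]] := repr_XPL_pt x v.
rewrite /XPL_mul uE vE TX_mul_trivT -/(XPL_pt _ _).
by rewrite v'v tmulC u'u tmulC.
Qed.

Definition XPL_inv q : XPL A := cls mrel (TX_inv (repr q)).

Lemma XPL_inv_pt a (x : set_type (UB a)) u :
  XPL_inv (XPL_pt x u) = XPL_pt x (tinv u).
Proof.
have [u' [uE _ u'u]] := repr_XPL_pt x u.
by rewrite /XPL_inv uE TX_inv_trivT -/(XPL_pt _ _).
Qed.

Lemma XPL_one_pt a (x : set_type (UB a)) :
  XPL_one (set_val x) = XPL_pt x (tone R n).
Proof. by rewrite /XPL_one TX_one_trivT. Qed.

Lemma TX_act_XPL_pt a (x : set_type (UB a)) u v :
  TX_act_XPL (trivT x u) (XPL_pt x v) = XPL_pt x (tmul u v).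
Proof.
have [v' [vE v'v _]] := repr_XPL_pt x v.
by rewrite /TX_act_XPL vE TX_mul_trivT -/(XPL_pt _ _).
Qed.

(** Points of one fiber have coordinates in a common chart, where the group
  laws are those of the torus. *)
Lemma XPL_at q b : piXPL q = b -> exists u, q = XPL_pt (at_index b) u.
Proof. by move=> qb; exact: XPL_over. Qed.

Lemma piXPL_one b : piXPL (XPL_one b : XPL A) = b.
Proof. by rewrite piXPL_cls piT_trivT. Qed.

Lemma piXPL_mul p q b : piXPL p = b -> piXPL q = b -> piXPL (XPL_mul p q) = b.
Proof.
by move=> /XPL_at [u ->] /XPL_at [v ->]; rewrite XPL_mul_pt piXPL_pt.
Qed.

Lemma piXPL_inv q b : piXPL q = b -> piXPL (XPL_inv q) = b.
Proof. by move=> /XPL_at [u ->]; rewrite XPL_inv_pt piXPL_pt. Qed.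

Lemma XPL_mulC p q b : piXPL p = b -> piXPL q = b -> XPL_mul p q = XPL_mul q p.
Proof. by move=> /XPL_at [u ->] /XPL_at [v ->]; rewrite !XPL_mul_pt tmulC. Qed.

Lemma XPL_mulA p q r b : piXPL p = b -> piXPL q = b -> piXPL r = b ->
  XPL_mul p (XPL_mul q r) = XPL_mul (XPL_mul p q) r.
Proof.
move=> /XPL_at [u ->] /XPL_at [v ->] /XPL_at [w ->].
by rewrite !XPL_mul_pt tmulA.
Qed.

Lemma XPL_mul1 q b : piXPL q = b -> XPL_mul q (XPL_one b) = q.
Proof.
by move=> /XPL_at [u ->]; rewrite (XPL_one_pt (at_index b)) XPL_mul_pt tmul1.
Qed.

Lemma XPL_mulV q b : piXPL q = b -> XPL_mul q (XPL_inv q) = XPL_one b.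
Proof.
move=> /XPL_at [u ->].
by rewrite XPL_inv_pt XPL_mul_pt tmulV (XPL_one_pt (at_index b)).
Qed.

Lemma XPL_one_continuous : continuous (@XPL_one R n X A).
Proof.
move=> b; have [a ab] := UB_cover b.
have oa : {in UB a, continuous (@XPL_one R n X A)}.
  rewrite -(continuous_open_subspace _ (@UB_open _ _ _ A a)).
  apply/subspace_sigL_continuousP.
  rewrite (_ : sigL _ _ = (fun x : set_type (UB a) => XPL_pt x (tone R n))).
    move=> x; apply: continuous_comp; first exact: trivT_continuous.
    exact: cls_continuous.
  by apply/funext => x; rewrite /sigL /= -XPL_one_pt.
by apply: oa; rewrite inE.
Qed.

(** The action of TX on X does not depend on the chart used to compute it, by
  equivariance of the transition maps. *)
Lemma TX_act_XE a (b : set_type (UB a)) u x : dom a x -> set_val b = muX A x ->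
  dom a (TX_act_X (trivT b u) x) /\
  chart_of a (TX_act_X (trivT b u) x) = tact u (chart_of a x).
Proof.
move=> ax bx; rewrite /TX_act_X; case: xgetP; last first.
  have [y ay yE] := chart_act u ax.
  by move=> /(_ y) []; exists a, b, u.
move=> y _ [a' [b' [u' [a'x a'y ut yE]]]].
have ay : dom a y by exact: dom_orbit a'x ax a'y yE.
have bb' : set_val b = set_val b' by rewrite -(piT_trivT b u) ut piT_trivT.
move: ut; rewrite (trivT_change u' bb') => /trivT_inj ->.
by split => //; exact: transition_act.
Qed.

End Model.

(** * Continuity of the group operations *)

Section LocalIso.
Variables (R : realType) (n : nat) (X : topologicalType) (A : atlas R n X).
Variables (a : index A) (h : X -> XPL A).
Hypothesis h_iso : local_iso a h.

Notation dom a := (chart_dom (chart_of a)).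
Local Notation c := (chart_of a).

Lemma local_iso_base x : dom a x -> piXPL (h x) = muX A x.
Proof. by move=> ax; have [_ base _] := h_iso; apply: base; apply/UB_muX. Qed.

Lemma local_iso_inj x y : dom a x -> dom a y -> h x = h y -> x = y.
Proof.
move=> ax ay; have [hh _ _] := h_iso.
by apply: (homeo_on_inj hh); apply/UB_muX.
Qed.

Lemma local_iso_surj q : UB a (piXPL q) -> exists2 x, dom a x & h x = q.
Proof.
move=> aq; have [hh _ _] := h_iso.
by have [x /= /UB_muX ax hx] := homeo_on_surj hh aq; exists x.
Qed.

Lemma local_iso_act (b : set_type (UB a)) x y u w : dom a x -> dom a y ->
  c y = tact u (c x) -> set_val b = muX A x -> h x = XPL_pt b w ->
  h y = XPL_pt b (tmul u w).
Proof.
move=> ax ay yE bx hx; have [_ _ act] := h_iso.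
have [az zE] := TX_act_XE u ax bx.
have -> : y = TX_act_X (trivT b u) x by apply: (chart_inj ay az); rewrite yE.
rewrite act; first by rewrite hx TX_act_XPL_pt.
  by apply/UB_muX.
by rewrite piT_trivT.
Qed.

(** The fibers of X are torsors, so the operation that they share with the
  model is p r^-1 q. In the chart it is z1 z2 / z3 in each coordinate: this
  makes no reference to a base section, and the convention x / 0 = 0 gives the
  right value on the coordinate hyperplanes. *)
Lemma local_iso_heap x1 x2 x3 y :
  dom a x1 -> dom a x2 -> dom a x3 -> dom a y ->
  muX A x1 = muX A x3 -> muX A x2 = muX A x3 ->
  h y = XPL_mul (XPL_mul (h x1) (XPL_inv (h x3))) (h x2) ->
  forall j, [/\ `|c x1 0 j| = `|c x3 0 j|, `|c x2 0 j| = `|c x3 0 j| &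
    c y 0 j = c x1 0 j * c x2 0 j / c x3 0 j].
Proof.
move=> ax1 ax2 ax3 ay x13 x23 hy j.
have [_ [u uE]] := muX_orbit ax3 (esym x13).
have [_ [v vE]] := muX_orbit ax3 (esym x23).
have ab : UB a (muX A x3) by apply/UB_muX.
pose b : set_type (UB a) := exist _ (muX A x3) (mem_set ab).
have [|w hx3] := @XPL_over _ _ _ _ a b (h x3); first exact: local_iso_base.
have bx3 : set_val b = muX A x3 by [].
have hx1 := local_iso_act ax3 ax1 uE bx3 hx3.
have hx2 := local_iso_act ax3 ax2 vE bx3 hx3.
have [y' ay' y'E] := chart_act (tmul u v) ax3.
have hy' := local_iso_act ax3 ay' y'E bx3 hx3.
have -> : y = y'.
  apply: (local_iso_inj ay ay'); rewrite hy hy' hx1 hx2 hx3.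
  rewrite XPL_inv_pt !XPL_mul_pt; congr XPL_pt.
  by rewrite -[tmul (tmul u w) _]tmulA tmulV tmul1 tmulA.
rewrite y'E uE vE !mxE !normrM !S1P !mul1r; split => //.
have [->|z0] := eqVneq (c x3 0 j) 0; first by rewrite !mulr0 mul0r.
by rewrite S1_val_mul !mulrA mulfK // mulrAC.
Qed.

(** Limits pass from the model to the chart a through the inverse of h, are
  combined there coordinatewise, and return through h. *)
Lemma local_iso_heap_cvg (I : Type) (F : set_system I) {FF : Filter F}
    (p q r m : I -> XPL A) (b : I -> BX A) (p0 q0 r0 m0 : XPL A) (b0 : BX A) :
  UB a b0 -> piXPL p0 = b0 -> piXPL q0 = b0 -> piXPL r0 = b0 ->
  (\forall i \near F, [/\ UB a (b i), piXPL (p i) = b i, piXPL (q i) = b i &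
     piXPL (r i) = b i]) ->
  (\forall i \near F, m i = XPL_mul (XPL_mul (p i) (XPL_inv (r i))) (q i)) ->
  m0 = XPL_mul (XPL_mul p0 (XPL_inv r0)) q0 ->
  p i @[i --> F] --> p0 -> q i @[i --> F] --> q0 -> r i @[i --> F] --> r0 ->
  m i @[i --> F] --> m0.
Proof.
move=> ab0 pp0 pq0 pr0 pF mE m0E pc qc rc; have [hh _ _] := h_iso.
have [x0 _ _] : exists2 x, dom a x & h x = p0.
  by apply: local_iso_surj; rewrite pp0.
(* The inverse of h; x0 is only a default value outside the image. *)
pose back s := xget x0 [set x | dom a x /\ h x = s].
have backP s : UB a (piXPL s) -> dom a (back s) /\ h (back s) = s.
  move=> /local_iso_surj [x ax hx]; rewrite /back.
  by case: xgetP => [y _ //|/(_ x)[]].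
have back_base s : UB a (piXPL s) -> muX A (back s) = piXPL s.
  by move=> /backP [ax {2}<-]; rewrite local_iso_base.
have back_cvg (s : I -> XPL A) (s0 : XPL A) : UB a (piXPL s0) ->
    (\forall i \near F, UB a (piXPL (s i))) ->
    s i @[i --> F] --> s0 -> c (back (s i)) @[i --> F] --> c (back s0).
  move=> as0 asF sc; have [a0 h0] := backP _ as0.
  have aF : \forall i \near F, dom a (back (s i)).
    by apply: filterS asF => i /backP [].
  apply: (homeo_on_cvg (chart_homeo c)) => //.
  apply: (homeo_on_cvg_inv hh).
  - by apply/UB_muX.
  - by apply: filterS aF => i ai; apply/UB_muX.
  - rewrite h0; apply: cvg_trans sc; apply: near_eq_cvg.
    by apply: filterS asF => i /backP [].
have pm (s t w : XPL A) (d : BX A) :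
    piXPL s = d -> piXPL t = d -> piXPL w = d ->
    piXPL (XPL_mul (XPL_mul s (XPL_inv w)) t) = d.
  by move=> sd td wd; do 2![apply: piXPL_mul => //]; exact: piXPL_inv.
have pm0 : piXPL m0 = b0 by rewrite m0E; exact: pm.
have mF : \forall i \near F, UB a (piXPL (m i)).
  by apply: filterS2 pF mE => i [abi pp pq pr] ->; rewrite (pm _ _ _ (b i)).
have [am0 hm0] : dom a (back m0) /\ h (back m0) = m0.
  by apply: backP; rewrite pm0.
suff : back (m i) @[i --> F] --> back m0.
  move=> mc.
  have : h (back (m i)) @[i --> F] --> h (back m0).
    apply: (homeo_on_cvg hh) => //; first by apply/UB_muX.
    by apply: filterS mF => i /backP [ai _]; apply/UB_muX.
  rewrite hm0; apply: cvg_trans; apply: near_eq_cvg.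
  by apply: filterS mF => i /backP [].
apply: (homeo_on_cvg_inv (chart_homeo c)) => //.
  by apply: filterS mF => i /backP [].
have coord (s t w v : XPL A) : v = XPL_mul (XPL_mul s (XPL_inv w)) t ->
    UB a (piXPL s) -> piXPL t = piXPL s -> piXPL w = piXPL s ->
    forall j, [/\ `|c (back s) 0 j| = `|c (back w) 0 j|,
      `|c (back t) 0 j| = `|c (back w) 0 j| &
      c (back v) 0 j =
      c (back s) 0 j * c (back t) 0 j / c (back w) 0 j].
  move=> vE as_ ts ws.
  have at_ : UB a (piXPL t) by rewrite ts.
  have aw : UB a (piXPL w) by rewrite ws.
  have av : UB a (piXPL v).
    by rewrite vE (pm _ _ _ (piXPL s)).
  have [d1 e1] := backP _ as_; have [d2 e2] := backP _ at_.
  have [d3 e3] := backP _ aw; have [d4 e4] := backP _ av.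
  apply: (local_iso_heap d1 d2 d3 d4).
  - by rewrite (back_base _ as_) (back_base _ aw) ws.
  - by rewrite (back_base _ at_) (back_base _ aw) ws.
  - by rewrite e1 e2 e3 e4.
have aF (s : I -> XPL A) : (forall i, [/\ UB a (b i), piXPL (p i) = b i,
    piXPL (q i) = b i & piXPL (r i) = b i] -> piXPL (s i) = b i) ->
    \forall i \near F, UB a (piXPL (s i)).
  by move=> sb; apply: filterS pF => i H; rewrite sb //; case: H.
have ap0 : UB a (piXPL p0) by rewrite pp0.
have cp := back_cvg p p0 ap0 (aF p (fun i H => let: And4 _ H _ _ := H in H)) pc.
have aq0 : UB a (piXPL q0) by rewrite pq0.
have cq := back_cvg q q0 aq0 (aF q (fun i H => let: And4 _ _ H _ := H in H)) qc.
have ar0 : UB a (piXPL r0) by rewrite pr0.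
have cr := back_cvg r r0 ar0 (aF r (fun i H => let: And4 _ _ _ H := H in H)) rc.
apply: cvg_row => j.
have [n1 _ ->] := coord p0 q0 r0 m0 m0E ap0
  (etrans pq0 (esym pp0)) (etrans pr0 (esym pp0)) j.
have cc (s : I -> XPL A) s0 : c (back (s i)) @[i --> F] --> c (back s0) ->
    c (back (s i)) 0 j @[i --> F] --> c (back s0) 0 j.
  move=> sc; apply: (cvg_comp _ (fun z : Cn R n => z 0 j) sc).
  exact: row_coord_continuous.
have E : \forall i \near F, [/\ `|c (back (p i)) 0 j| = `|c (back (r i)) 0 j|,
      `|c (back (q i)) 0 j| = `|c (back (r i)) 0 j| &
      c (back (m i)) 0 j =
      c (back (p i)) 0 j * c (back (q i)) 0 j / c (back (r i)) 0 j].
  by apply: filterS2 pF mE => i [abi pp pq pr] miE; apply: coord; rewrite ?pp.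
have E1 : \forall i \near F, `|c (back (p i)) 0 j| = `|c (back (r i)) 0 j| /\
    `|c (back (q i)) 0 j| = `|c (back (r i)) 0 j|.
  by apply: filterS E => i [].
apply: cvg_trans (cvg_mul_div_norm E1 n1 (cc _ _ cp) (cc _ _ cq) (cc _ _ cr)).
by apply: near_eq_cvg; apply: filterS E => i [].
Qed.

End LocalIso.

(** * Cech cohomology of the model and the Euler class *)

(** The computation behind the transitivity of cohomology. The operation is
  abstract so that unification does not unfold the quotients that define the
  model. *)
Lemma paste_equations (G : Type) (P : set G) (op : G -> G -> G)
    (opP : forall x y, P x -> P y -> P (op x y))
    (opA : forall x y z, P x -> P y -> P z -> op x (op y z) = op (op x y) z)
    (c s t d d1 d2 d' s' t' e : G) :
  P c -> P s -> P t -> P d -> P d1 -> P d2 -> P d' -> P s' -> P t' -> P e ->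
  op c s = op t d -> op d d1 = op d2 d' -> op d' s' = op t' e ->
  op c (op (op s d1) s') = op (op (op t d2) t') e.
Proof.
move=> Pc Ps Pt Pd Pd1 Pd2 Pd' Ps' Pt' Pe E1 E2 E3.
rewrite (opA _ _ _ Pc (opP _ _ Ps Pd1) Ps') (opA _ _ _ Pc Ps Pd1) E1.
rewrite -(opA _ _ _ Pt Pd Pd1) E2 (opA _ _ _ Pt Pd2 Pd').
have Ptd2 := opP _ _ Pt Pd2.
by rewrite -(opA _ _ _ Ptd2 Pd' Ps') E3 (opA _ _ _ Ptd2 Pt' Pe).
Qed.

Section EulerClass.
Variables (R : realType) (n : nat) (X : topologicalType) (A : atlas R n X).
Variable h : index A -> X -> XPL A.
Hypothesis h_iso : forall a, local_iso a (h a).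

Notation dom a := (chart_dom (chart_of a)).
Implicit Types (V : set (BX A)) (p q r : BX A -> XPL A) (c d e : cochain1 A).

(** Continuity is local, and near any point some h_a is available. *)
Lemma sheaf_section_heap V p q r (m : BX A -> XPL A) :
  sheaf_section V p -> sheaf_section V q -> sheaf_section V r ->
  (forall b, V b -> m b = XPL_mul (XPL_mul (p b) (XPL_inv (r b))) (q b)) ->
  sheaf_section V m.
Proof.
move=> [/subspace_continuousP pc pb] [/subspace_continuousP qc qb]
  [/subspace_continuousP rc rb] mE; split; last first.
  move=> b Vb; rewrite mE //; apply: piXPL_mul; last exact: qb.
  by apply: piXPL_mul; [exact: pb|apply: piXPL_inv; exact: rb].
apply/subspace_continuousP => b Vb; have [a ab] := UB_cover b.
have Vw : within V (nbhs b) V by exact: withinT.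
have aw : within V (nbhs b) (UB a).
  apply: (@cvg_within _ (nbhs b) _ V).
  by apply: open_nbhs_nbhs; split => //; exact: (@UB_open _ _ _ A a).
apply: (local_iso_heap_cvg (h_iso a) (F := within V (nbhs b)) (b := id) ab
  (pb _ Vb) (qb _ Vb) (rb _ Vb) _ _ _ (pc _ Vb) (qc _ Vb) (rc _ Vb)).
- apply: filterS2 Vw aw => i Vi ai.
  by split => //; [exact: pb|exact: qb|exact: rb].
- by apply: filterS Vw => i Vi; exact: mE.
- exact: mE.
Qed.

Lemma sheaf_section_one V : sheaf_section V (@XPL_one R n X A).
Proof.
split=> [|b _]; last exact: piXPL_one.
exact/continuous_subspaceT/XPL_one_continuous.
Qed.

Lemma sheaf_section_inv V p : sheaf_section V p ->
  sheaf_section V (fun b => XPL_inv (p b)).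
Proof.
move=> sp; have s1 := sheaf_section_one V.
apply: (sheaf_section_heap s1 s1 sp) => b Vb.
have pb := piXPL_inv (sp.2 b Vb).
rewrite (XPL_mul1 (b := b)); last by apply: piXPL_mul => //; exact: piXPL_one.
by rewrite (XPL_mulC (piXPL_one _) pb) (XPL_mul1 pb).
Qed.

Lemma XPL_inv1 b : XPL_inv (XPL_one b : XPL A) = XPL_one b.
Proof.
have b1 := piXPL_one b; have bV := piXPL_inv b1.
by rewrite -[RHS](XPL_mulV b1) (XPL_mulC b1 bV) (XPL_mul1 bV).
Qed.

Lemma sheaf_section_mul V p q : sheaf_section V p -> sheaf_section V q ->
  sheaf_section V (fun b => XPL_mul (p b) (q b)).
Proof.
move=> sp sq; apply: (sheaf_section_heap sp sq (sheaf_section_one V)) => b Vb.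
by rewrite XPL_inv1 (XPL_mul1 (sp.2 b Vb)).
Qed.

Lemma sheaf_sectionW V (W : set (BX A)) p : W `<=` V ->
  sheaf_section V p -> sheaf_section W p.
Proof.
move=> WV [pc pb]; split=> [|b /WV]; last exact: pb.
exact: continuous_subspaceW pc.
Qed.

Lemma cocycle1_base c j k b : cocycle1 c -> cov j b -> cov k b ->
  piXPL (c j k b) = b.
Proof. by move=> [_ sc _] jb kb; apply: (sc j k).2. Qed.

Lemma XPL_mul_swap (s t u v : XPL A) b :
  piXPL s = b -> piXPL t = b -> piXPL u = b -> piXPL v = b ->
  XPL_mul u s = XPL_mul t v -> XPL_mul v (XPL_inv s) = XPL_mul (XPL_inv t) u.
Proof.
move=> /XPL_at[s' ->] /XPL_at[t' ->] /XPL_at[u' ->] /XPL_at[v' ->].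
rewrite !XPL_inv_pt !XPL_mul_pt.
move=> /(congr1 (XPL_mul (XPL_pt (at_index b) (tmul (tinv s') (tinv t'))))).
rewrite !XPL_mul_pt => E.
transitivity
  (XPL_pt (at_index b) (tmul (tmul (tinv s') (tinv t')) (tmul t' v'))).
  congr XPL_pt; apply: torusP => j; rewrite !mxE !S1E.
  by field; rewrite !S1_val_neq0.
rewrite -E; congr XPL_pt; apply: torusP => j; rewrite !mxE !S1E.
by field; rewrite !S1_val_neq0.
Qed.

Lemma cohomologous_sym c d : cocycle1 c -> cocycle1 d ->
  cohomologous c d -> cohomologous d c.
Proof.
move=> cc cd [J [W [rc [rd [s [oW subW ss eqs]]]]]].
exists J, W, rd, rc, (fun j b => XPL_inv (s j b)); split.
- exact: oW.
- by move=> j; have [] := subW j.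
- by move=> j; exact: sheaf_section_inv.
- move=> j k b jb kb; have [[cj dj] [ck dk]] := (subW j, subW k).
  apply: (@XPL_mul_swap _ _ _ _ b);
    [exact: (ss k).2|exact: (ss j).2|..|exact: eqs].
    by apply: cocycle1_base => //; [exact: cj|exact: ck].
  by apply: cocycle1_base => //; [exact: dj|exact: dk].
Qed.

(** The two refinements may send a point to different members of the cover of
  d; the discrepancy is the section d (rd j) (rd' j') of the cocycle itself. *)
Lemma cohomologous_trans c d e : cocycle1 c -> cocycle1 d -> cocycle1 e ->
  cohomologous c d -> cohomologous d e -> cohomologous c e.
Proof.
move=> cc cd ce [J [W [rc [rd [s [[oW cW] subW ss eqs]]]]]].
move=> [J' [W' [rd' [re [s' [[oW' cW'] subW' ss' eqs']]]]]].
exists (J * J')%type, (fun j => W j.1 `&` W' j.2).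
exists (fun j => rc j.1), (fun j => re j.2), (fun j b =>
  XPL_mul (XPL_mul (s j.1 b) (d (rd j.1) (rd' j.2) b)) (s' j.2 b)).
have [_ sd dM] := cd.
split.
- split=> [j|b]; first exact: openI.
  by have [j jb] := cW b; have [j' jb'] := cW' b; exists (j, j').
- move=> j; split=> b [jb jb']; first exact: (subW _).1.
  exact: (subW' _).2.
- move=> [j j']; apply: sheaf_section_mul; first apply: sheaf_section_mul.
  + by apply: sheaf_sectionW (ss j) => b [].
  + apply: sheaf_sectionW (sd _ _) => b [jb jb'].
    by split; [exact: (subW j).2|exact: (subW' j').1].
  + by apply: sheaf_sectionW (ss' j') => b [].
- move=> [j j'] [k k'] b /= [jb jb'] [kb kb'].
  have E := eqs _ _ _ jb kb; have E' := eqs' _ _ _ jb' kb'.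
  have [cj dj] := (((subW j).1 _ jb), ((subW j).2 _ jb)).
  have [ck dk] := (((subW k).1 _ kb), ((subW k).2 _ kb)).
  have [dj' ej'] := (((subW' j').1 _ jb'), ((subW' j').2 _ jb')).
  have [dk' ek'] := (((subW' k').1 _ kb'), ((subW' k').2 _ kb')).
  have D12 := etrans (dM _ _ _ _ dj dk dk') (esym (dM _ _ _ _ dj dj' dk')).
  apply: (@paste_equations _ [set q | piXPL q = b] (@XPL_mul R n X A) _ _
    _ _ _ _ _ _ _ _ _ _ _ _ _ _ _ _ _ _ _ _ E D12 E').
  + by move=> x y; exact: piXPL_mul.
  + by move=> x y z; exact: XPL_mulA.
  + exact: cocycle1_base cc cj ck.
  + exact: (ss k).2.
  + exact: (ss j).2.
  + exact: cocycle1_base cd dj dk.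
  + exact: cocycle1_base cd dk dk'.
  + exact: cocycle1_base cd dj dj'.
  + exact: cocycle1_base cd dj' dk'.
  + exact: (ss' k').2.
  + exact: (ss' j').2.
  + exact: cocycle1_base ce ej' ek'.
Qed.

Definition trivial_cochain : cochain1 A :=
  Cochain1 (fun=> setT) (fun _ _ : unit => @XPL_one R n X A).

Lemma trivial_cocycle : cocycle1 trivial_cochain.
Proof.
split.
- by split=> [j|b]; [exact: openT|exists tt].
- by move=> j k; exact: sheaf_section_one.
- by move=> j k l b _ _ _ /=; rewrite (XPL_mul1 (piXPL_one b)).
Qed.

Lemma trivial_cohomologous : cohomologous trivial_cochain trivial_cochain.
Proof.
exists unit, (fun=> setT), id, id, (fun=> @XPL_one R n X A); split.
- by split=> [j|b]; [exact: openT|exists tt].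
- by move=> j; split.
- by move=> j; exact: sheaf_section_one.
- by [].
Qed.

Section FromSection.
Variable s : BX A -> X.
Hypotheses (s_cont : continuous s) (sK : forall b, muX A (s b) = b).

Lemma section_dom a b : UB a b -> dom a (s b).
Proof. by rewrite -{1}(sK b) => /UB_muX. Qed.

Lemma sheaf_section_local_iso a : sheaf_section (UB a) (h a \o s).
Proof.
have [hh _ _] := h_iso a.
split=> [|b ab]; last first.
  by rewrite /= (local_iso_base (h_iso a)) ?sK //; exact: section_dom.
apply/subspace_continuousP => b ab.
apply: (homeo_on_cvg hh); first by rewrite /= sK.
  have : within (UB a) (nbhs b) (UB a) by exact: withinT.
  by apply: filterS => b' ab'; rewrite /= sK.
exact: cvg_within_filter (@s_cont b).
Qed.

(** The only possible value of the Euler cocycle, as is seen by evaluating its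
  defining equation at s b. *)
Definition section_cocycle a a' b := XPL_mul (h a (s b)) (XPL_inv (h a' (s b))).

Lemma section_cocycleP : euler_cocycle h section_cocycle.
Proof.
have base a b : UB a b -> piXPL (h a (s b)) = b.
  exact: (sheaf_section_local_iso a).2.
split; first split.
- by split=> [a|b]; [exact: (@UB_open _ _ _ A a)|exact: UB_cover].
- move=> a a'; apply: sheaf_section_mul; last apply: sheaf_section_inv.
    by apply: sheaf_sectionW (sheaf_section_local_iso a) => b [].
  by apply: sheaf_sectionW (sheaf_section_local_iso a') => b [].
- move=> a a' a'' b /= /base ab /base a'b /base a''b; rewrite /section_cocycle.
  move: ab a'b a''b => /XPL_at [u ->] /XPL_at [v ->] /XPL_at [w ->].
  rewrite !XPL_inv_pt !XPL_mul_pt; congr XPL_pt; apply: torusP => j.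
  by rewrite !mxE !S1E; field; rewrite !S1_val_neq0.
- (* The element of TX that moves s b to y acts on both h_a (s b) and
     h_a' (s b), and cancels from their quotient. *)
  move=> a a' y ay a'y; set b := muX A y.
  have ay_ := (UB_muX a y).1 ay; have asb := section_dom ay.
  have [_ [u uE]] := muX_orbit asb (sK b).
  pose x : set_type (UB a) := exist _ b (mem_set ay).
  have xE : set_val x = muX A (s b) by rewrite sK.
  have [az zE] := TX_act_XE u asb xE.
  have -> : y = TX_act_X (trivT x u) (s b).
    by apply: (chart_inj ay_ az); rewrite uE zE.
  have [[_ _ acta] [_ _ acta']] := (h_iso a, h_iso a').
  have asb' : UB a (muX A (s b)) by rewrite sK.
  have a'sb' : UB a' (muX A (s b)) by rewrite sK.
  have tb : piT (trivT x u) = muX A (s b) by rewrite piT_trivT sK.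
  rewrite (acta _ _ asb' tb) (acta' _ _ a'sb' tb).
  have [w wE] := @XPL_over _ _ _ _ a x _ (base _ _ ay).
  have [w' w'E] := @XPL_over _ _ _ _ a x _ (base _ _ a'y).
  rewrite /section_cocycle wE w'E !TX_act_XPL_pt XPL_inv_pt !XPL_mul_pt.
  congr XPL_pt; apply: torusP => j.
  by rewrite !mxE !S1E; field; rewrite !S1_val_neq0.
Qed.

(** The defining equation of theta at s b says that theta is the coboundary of
  the local sections h_a o s. *)
Lemma euler_cocycle_trivial theta : euler_cocycle h theta ->
  cohomologous (Cochain1 (@UB R n X A) theta) trivial_cochain.
Proof.
move=> [[[oU cU] _ _] thE].
exists (index A), (@UB R n X A), id, (fun=> tt), (fun a => h a \o s); split.
- by split.
- by move=> a; split.
- exact: sheaf_section_local_iso.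
- move=> a a' b ab a'b /=; have [_ base] := sheaf_section_local_iso a.
  rewrite (XPL_mul1 (base b ab)) [RHS]/= (thE a a' (s b)) ?sK //.
Qed.

Lemma section_euler_class : euler_class h = H1_zero A.
Proof.
apply/funext => d; apply/propext; split=> [[theta eth [cd thd]]|[cd td]].
  have th1 := euler_cocycle_trivial eth.
  split; first exact: cd.
  apply: (cohomologous_trans trivial_cocycle eth.1 cd _ thd).
  exact: cohomologous_sym eth.1 trivial_cocycle th1.
have th1 := euler_cocycle_trivial section_cocycleP.
exists section_cocycle; first exact: section_cocycleP.
split; first exact: cd.
exact: (cohomologous_trans section_cocycleP.1 trivial_cocycle cd th1 td).
Qed.

End FromSection.

(** If theta_jk p_k = p_j, the points of X that h_j and h_k send to p_j(b) and
  p_k(b) are the same. *)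
Lemma trivialization_section theta : euler_cocycle h theta ->
  cohomologous (Cochain1 (@UB R n X A) theta) trivial_cochain ->
  exists s : BX A -> X, continuous s /\ forall b, muX A (s b) = b.
Proof.
move=> [_ thE] [J [W [ra [rt [p [[oW cW] subW sp eqp]]]]]].
have pE j b : W j b ->
    exists x, [/\ dom (ra j) x, h (ra j) x = p j b & muX A x = b].
  move=> jb; have ab := (subW j).1 _ jb; have pb := (sp j).2 _ jb.
  have [|x ax hx] := @local_iso_surj _ _ _ _ _ _ (h_iso (ra j)) (p j b).
    by rewrite pb.
  by exists x; split => //; rewrite -(local_iso_base (h_iso (ra j)) ax) hx.
have [s sE] : exists s : BX A -> X, forall b j, W j b ->
    [/\ dom (ra j) (s b), h (ra j) (s b) = p j b & muX A (s b) = b].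
  have : forall b, exists x, forall j, W j b ->
      [/\ dom (ra j) x, h (ra j) x = p j b & muX A x = b].
    move=> b; have [k kb] := cW b; have [x [kx hx xb]] := pE k b kb.
    exists x => j jb; have jx : dom (ra j) x.
      by apply/UB_muX; rewrite xb; exact: (subW j).1.
    split => //; rewrite (thE (ra j) (ra k)); [|exact/UB_muX..].
    by rewrite hx xb (eqp _ _ _ jb kb) (XPL_mul1 ((sp j).2 _ jb)).
  by move=> /choice [s sE]; exists s => b j; exact: sE.
exists s; split=> [b|b]; last by have [j /sE []] := cW b.
have [j jb] := cW b; have [hh _ _] := h_iso (ra j).
have jN : nbhs b (W j) by apply: open_nbhs_nbhs; split => //; exact: oW.
have [sb hsb _] := sE _ _ jb.
apply: (homeo_on_cvg_inv hh (F := nbhs b) (g := s)).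
  by apply/UB_muX.
  by apply: filterS jN => b' /sE [jb' _ _]; apply/UB_muX.
have pc : p j b' @[b' --> b] --> p j b.
  have [] := sp j; rewrite (continuous_open_subspace _ (oW j)) => pc _.
  by apply: pc; rewrite inE.
rewrite hsb; apply: cvg_trans pc; apply: near_eq_cvg.
by apply: filterS jN => b' /sE [].
Qed.

End EulerClass.

Theorem theorem5p6 (R : realType) (n : nat) (X : topologicalType)
    (compactX : compact [set: X]) (hausdorffX : hausdorff_space X)
    (T : local_action R n X) (A : atlas R n X) 
    (TA : local_action_atlases T A)
    (h : index A -> X -> XPL A) (h_iso : forall a, local_iso a (h a)) :
  (exists s : BX A -> X, continuous s /\ forall b, muX A (s b) = b) <->
  euler_class h = H1_zero A.
Proof.
split=> [[s [s_cont sK]]|h0]; first exact: section_euler_class s_cont sK.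
have : H1_zero A (trivial_cochain A).
  by split; [exact: trivial_cocycle|exact: trivial_cohomologous].
rewrite -h0 => -[theta eth [_ th0]].
refine (trivialization_section h_iso eth th0).
Qed.
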